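(* Let $s\ge 0$ be an integer and let $S$ be an orientation of the undirected star $K_{1,s}$, with center $v$ (a vertex of total degree $s$). Then: (1) $S$ has the tournament Sidorenko property if and only if $S$ has a homomorphism to a single directed edge (i.e. all edges at $v$ point into $v$, or all point out of $v$); (2) $S$ has the tournament anti-Sidorenko property if and only if the in-degree and the out-degree of $v$ in $S$ differ by at most one.
   Context: All digraphs are oriented graphs (no loops, no antiparallel edges). A tournament is an orientation of a complete graph without loops. A homomorphism $D\to T$ between digraphs is a map $\phi:V(D)\to V(T)$ with $(\phi(x),\phi(y))\in E(T)$ for all $(x,y)\in E(D)$; $h_D(T)$ counts them and $t_D(T)=h_D(T)/v(T)^{v(D)}$. $D$ has the tournament Sidorenko property if $t_D(T)\ge (1-o(1))2^{-e(D)}$ for all tournaments $T$, where $o(1)\to0$ as the number of vertices of $T$ tends to infinity; $D$ has the tournament anti-Sidorenko property if $t_D(T)\le 2^{-e(D)}$ for all tournaments $T$. *)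

(* Defs.v *)
From mathcomp Require Import all_boot all_order all_algebra.
Set Implicit Arguments.
Unset Strict Implicit.
Unset Printing Implicit Defensive.
Import Order.TTheory GRing.Theory Num.Theory.
Local Open Scope ring_scope.

(* Digraphs and undirected graphs are given by their (adjacency) relation on a
   finite type of vertices. [D] is an orientation of the undirected graph [G]
   when each edge of [G] carries exactly one of its two directions in [D], and
   [D] has no other edges. *)
Definition orientation (V : finType) (G D : rel V) : Prop :=
  (forall x y, G x y = D x y || D y x) /\
  (forall x y, D x y -> ~~ D y x).

Definition complete_graph (V : finType) : rel V := [rel x y | x != y].

Definition tournament (W : finType) (T : rel W) : Prop :=
  orientation (@complete_graph W) T.

Definition star_graph (V : finType) (v : V) : rel V :=
  [rel x y | (x != y) && ((x == v) || (y == v))].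

(* Since #|V| = s + 1, [star_graph v] is a copy of K_{1,s} with center v. *)
Definition star_orientation (s : nat) (V : finType) (S : rel V) (v : V) : Prop :=
  #|V| = s.+1 /\ orientation (star_graph v) S.

Definition indeg (V : finType) (D : rel V) (v : V) : nat := #|[set x | D x v]|.
Definition outdeg (V : finType) (D : rel V) (v : V) : nat := #|[set x | D v x]|.

Definition num_edges (V : finType) (D : rel V) : nat :=
  #|[set p : V * V | D p.1 p.2]|.

Definition is_hom (V W : finType) (D : rel V) (T : rel W) (f : {ffun V -> W}) :
  bool := [forall x, forall y, D x y ==> T (f x) (f y)].

Definition hom_count (V W : finType) (D : rel V) (T : rel W) : nat :=
  #|[set f : {ffun V -> W} | is_hom D T f]|.

Definition hom_density (V W : finType) (D : rel V) (T : rel W) : rat :=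
  (hom_count D T)%:R / (#|W| ^ #|V|)%:R.

(* The digraph on two vertices whose only edge goes from [false] to [true]. *)
Definition directed_edge : rel bool := [rel x y | ~~ x && y].

(* The error term o(1), which depends only on the number of vertices of T, is
   spelled out with an arbitrary [eps > 0]. *)
Definition tournament_Sidorenko (V : finType) (D : rel V) : Prop :=
  forall eps : rat, 0 < eps ->
  exists n0 : nat, forall (W : finType) (T : rel W),
    tournament T -> (n0 <= #|W|)%N ->
    (1 - eps) * 2^-1 ^+ num_edges D <= hom_density D T.

Definition tournament_anti_Sidorenko (V : finType) (D : rel V) : Prop :=
  forall (W : finType) (T : rel W),
    tournament T -> (0 < #|W|)%N ->
    hom_density D T <= 2^-1 ^+ num_edges D.

(* Main.v *)
(* With a = indeg v and b = outdeg v, the number of homomorphisms from the star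
   to T is the sum over w of indeg(w)^a outdeg(w)^b. If a b = 0, convexity gives
   the lower bound; if |a - b| <= 1, AM-GM applied to indeg(w) outdeg(w) gives
   the upper bound. For the converses, up to reversal a <= b, and the tournament
   is a regular block of relative size q dominating, or dominated by, a regular
   block of relative size 1 - q: to first order in q this multiplies the density
   by 1 + q (a - b - 1) when a, b > 0, resp. by at least 1 + q (b - a - 1). *)
Require Import Defs.
From mathcomp Require Import all_boot all_order all_algebra.
From mathcomp Require Import zify ring lra.
Import Order.TTheory GRing.Theory Num.Theory.
Local Open Scope ring_scope.

(** * Degrees and reversal in tournaments *)

Section Degrees.
Local Open Scope nat_scope.

Lemma tournament_deg {W : finType} {T : rel W} (hT : tournament T) w :
  (indeg T w + outdeg T w).+1 = #|W|.
Proof.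
rewrite /indeg /outdeg -cardsUI.
have -> : [set x | T x w] :&: [set x | T w x] = set0.
  apply/setP => x; rewrite !inE; apply/negbTE/negP => /andP[h1 h2].
  by have := hT.2 _ _ h1; rewrite h2.
rewrite cards0 addn0 -cardsT [RHS](cardsD1 w) inE; congr _.+1.
apply: eq_card => x; rewrite !inE andbT.
exact: (esym (hT.1 x w)).
Qed.

Lemma sum_indeg_outdeg {W : finType} (T : rel W) :
  \sum_w indeg T w = \sum_w outdeg T w.
Proof.
transitivity (\sum_w \sum_x (T x w : nat)).
  by apply: eq_bigr => w _; rewrite /indeg -sum1dep_card big_mkcond.
rewrite exchange_big; apply: eq_bigr => w _.
by rewrite /outdeg -sum1dep_card [RHS]big_mkcond.
Qed.

Lemma tournament_sum_outdeg {W : finType} {T : rel W} (hT : tournament T) :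
  2 * (\sum_w outdeg T w) = #|W| * #|W|.-1.
Proof.
rewrite mul2n -addnn -[X in X + _]sum_indeg_outdeg -big_split /=.
rewrite (eq_bigr (fun=> #|W|.-1)) ?sum_nat_const // => w _.
by rewrite -(tournament_deg hT w).
Qed.

(** Reversal swaps in- and out-degrees by conversion, so each construction below only has to treat
    one order of [a] and [b]. *)
Definition reverse {W : finType} (T : rel W) : rel W := [rel x y | T y x].

Lemma reverse_tournament {W : finType} {T : rel W} :
  tournament T -> tournament (reverse T).
Proof.
case=> h1 h2; split=> x y /=; first by rewrite orbC; exact: h1.
exact: h2.
Qed.

End Degrees.

(** * Oriented stars: edges, homomorphism count, maps to a single edge *)

Section Star.
Variables (s : nat) (V : finType) (S : rel V) (v : V).
Hypothesis hS : star_orientation s S v.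
Local Open Scope nat_scope.

Lemma star_edge x y : S x y -> x != y /\ (x == v) || (y == v).
Proof.
move=> h; have := hS.2.1 x y; rewrite h /star_graph /= => /andP[]; by split.
Qed.

Lemma star_leaf x : x != v -> S v x = ~~ S x v.
Proof.
move=> h; have := hS.2.1 x v; rewrite /star_graph /= h eqxx orbT /=.
have := hS.2.2 x v.
by case: (S x v) => /= [/(_ isT)/negbTE ->|_ <-].
Qed.

Lemma star_irr : S v v = false.
Proof. by apply/negP => /star_edge[]; rewrite eqxx. Qed.

Lemma star_outdegE : outdeg S v = #|[set x | (x != v) && ~~ S x v]|.
Proof.
apply: eq_card => x; rewrite !inE.
by case: eqVneq => [->|/star_leaf //]; rewrite star_irr.
Qed.

Lemma star_indegE : indeg S v = #|[set x | (x != v) && S x v]|.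
Proof.
apply: eq_card => x; rewrite !inE.
by case: eqVneq => [->|//]; rewrite star_irr.
Qed.

Lemma star_deg : indeg S v + outdeg S v = s.
Proof.
rewrite star_indegE star_outdegE -cardsUI.
have -> : [set x | (x != v) && S x v] :&: [set x | (x != v) && ~~ S x v] = set0.
  by apply/setP => x; rewrite !inE; case: (x != v); case: (S x v).
rewrite cards0 addn0; apply: succn_inj; rewrite -hS.1 -cardsT [RHS](cardsD1 v) inE.
by congr _.+1; apply: eq_card => x; rewrite !inE andbT -andb_orr orbN andbT.
Qed.

Lemma star_num_edges : num_edges S = s.
Proof.
rewrite /num_edges -star_deg /indeg /outdeg.
rewrite -(card_imset [set x | S x v] (f := fun x => (x, v))); last first.
  by move=> x y [].
rewrite -(card_imset [set x | S v x] (f := fun x => (v, x))); last first.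
  by move=> x y [].
rewrite -cardsUI [X in _ + X](_ : _ = 0).
  rewrite addn0; apply: eq_card => -[x y]; rewrite !inE /=; apply/idP/orP.
    move=> h; case: (star_edge _ _ h) => _ /orP[]/eqP e; subst.
      by right; apply: imset_f; rewrite inE.
    by left; apply: imset_f; rewrite inE.
  by case=> /imsetP[z]; rewrite inE => hz [-> ->].
(* A pair lying in both images would be a loop at [v]. *)
apply/eqP; rewrite cards_eq0; apply/set0Pn => -[[x y]]; rewrite inE.
case/andP=> /imsetP[z1]; rewrite inE => h1 [-> ->] /imsetP[z2].
by rewrite inE => h2 [e1 e2]; rewrite e1 star_irr in h1.
Qed.

(** Allowed images of [x] once the center is sent to [w]. With one predicate per vertex, the
    homomorphisms with [f v = w] form a [family], whose cardinality is a product. *)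
Definition star_fiber {W : finType} (T : rel W) (w : W) (x : V) : pred W :=
  if x == v then pred1 w
  else if S x v then [pred y | T y w] else [pred y | T w y].

Lemma star_homE {W : finType} (T : rel W) (f : {ffun V -> W}) w :
  is_hom S T f && (f v == w) = (f \in family (star_fiber T w)).
Proof.
apply/andP/familyP => [[/forallP hf /eqP <-] x|hf].
  rewrite /star_fiber; case: eqVneq => [->|xv]; first by rewrite inE.
  case: ifP => h; first by have /forallP/(_ v)/implyP/(_ h) := hf x.
  have h' : S v x by rewrite star_leaf // h.
  by have /forallP/(_ x)/implyP/(_ h') := hf v.
have fv : f v = w by have := hf v; rewrite /star_fiber eqxx inE => /eqP.
split; last exact/eqP.
apply/forallP => x; apply/forallP => y; apply/implyP => h.
have [xy /orP[]/eqP e] := star_edge _ _ h; subst.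
  have := hf y; rewrite /star_fiber eq_sym (negbTE xy).
  by rewrite (negbTE (hS.2.2 _ _ h)) inE.
by have := hf x; rewrite /star_fiber (negbTE xy) h inE.
Qed.

(** Once the image [w] of the center is fixed, the leaves are mapped independently: those with an
    edge into [v] to in-neighbours of [w], the others to out-neighbours. *)
Lemma star_hom_count {W : finType} (T : rel W) :
  hom_count S T = \sum_w indeg T w ^ indeg S v * outdeg T w ^ outdeg S v.
Proof.
rewrite /hom_count -sum1_card (partition_big (fun f : {ffun V -> W} => f v) predT) //=.
apply: eq_bigr => w _.
rewrite (eq_bigl [in family (star_fiber T w)]); last first.
  by move=> f; rewrite inE star_homE.
rewrite sum1_card card_family foldrE big_map enumT -/(index_enum V).
rewrite (bigD1 v) //= {1}/star_fiber eqxx card1 mul1n.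
rewrite (bigID (fun x => S x v)) /= star_indegE star_outdegE.
congr (_ * _); rewrite -prod_nat_const.
  apply: eq_big => [x|x /andP[xv h]]; first by rewrite inE.
  rewrite /star_fiber (negbTE xv) h /indeg; apply: eq_card => y.
  by rewrite !inE.
apply: eq_big => [x|x /andP[xv /negbTE h]]; first by rewrite inE.
rewrite /star_fiber (negbTE xv) h /outdeg; apply: eq_card => y.
by rewrite !inE.
Qed.

Lemma star_hom_edge :
  (exists f : {ffun V -> bool}, is_hom S directed_edge f) <->
  (forall x y, S x y -> y = v) \/ (forall x y, S x y -> x = v).
Proof.
split=> [[f /forallP hf]|].
  have {}hf x y : S x y -> f x = false /\ f y.
    by have /forallP/(_ y)/implyP h := hf x; move/h => /= /andP[/negbTE].
  (* The value at the center decides: a vertex sent to [true] is never a tail, and one sent to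
     [false] is never a head. *)
  case fv: (f v); [left|right] => x y h; have [fx fy] := hf _ _ h;
    have [_ /orP[]/eqP e] := star_edge _ _ h => //; subst.
  - by rewrite fv in fx.
  - by rewrite fv in fy.
case=> h.
  exists [ffun x => x == v]; apply/forallP => x; apply/forallP => y.
  apply/implyP => hxy; rewrite /directed_edge /= !ffunE (h _ _ hxy) eqxx andbT.
  by have [] := star_edge _ _ hxy; rewrite (h _ _ hxy).
exists [ffun x => x != v]; apply/forallP => x; apply/forallP => y.
apply/implyP => hxy; rewrite /directed_edge /= !ffunE (h _ _ hxy) eqxx /= eq_sym.
by have [] := star_edge _ _ hxy; rewrite (h _ _ hxy).
Qed.

Lemma star_in_or_out :
  (forall x y, S x y -> y = v) \/ (forall x y, S x y -> x = v) <->
  outdeg S v = 0 \/ indeg S v = 0.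
Proof.
split=> -[] h; [left|right|left|right].
- apply/eqP; rewrite cards_eq0; apply/set0Pn => -[y]; rewrite inE => hy.
  by have e := h _ _ hy; rewrite e star_irr in hy.
- apply/eqP; rewrite cards_eq0; apply/set0Pn => -[y]; rewrite inE => hy.
  by have e := h _ _ hy; rewrite e star_irr in hy.
- move=> x y hxy; have [_ /orP[]/eqP e //] := star_edge _ _ hxy.
  by move/eqP: h; rewrite cards_eq0 => /set0Pn[]; exists y; rewrite inE -e.
- move=> x y hxy; have [_ /orP[]/eqP e //] := star_edge _ _ hxy.
  by move/eqP: h; rewrite cards_eq0 => /set0Pn[]; exists x; rewrite inE -e.
Qed.

End Star.

(** * Regular circulant tournaments and their ordered sums *)

Section Blocks.
Local Open Scope nat_scope.

(** A regular tournament on the integers modulo [2r+1]. As the modulus is odd, exactly one of [d]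
    and [-d] lies in [1..r] for each nonzero [d]. *)
Definition circulant (r : nat) : rel 'I_r.*2.+1 :=
  [rel i j : 'I_r.*2.+1 | 0 < nat_of_ord (j - i)%R <= r].

Lemma circulant_tournament r : tournament (circulant r).
Proof.
(* The reduction modulo [2r+1] only acts when [i = j]; otherwise the two differences add up to
   [2r+1]. *)
have opp (i j : 'I_r.*2.+1) :
    nat_of_ord (i - j)%R = (r.*2.+1 - nat_of_ord (j - i)%R) %% r.*2.+1.
  by rewrite -[(i - j)%R]GRing.opprB.
have eq0 (i j : 'I_r.*2.+1) : (i == j) = (nat_of_ord (i - j)%R == 0).
  by rewrite -GRing.subr_eq0 -(inj_eq val_inj).
have circE i j : circulant r i j = (0 < nat_of_ord (j - i)%R <= r) by [].
split=> i j; rewrite !circE.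
  rewrite [complete_graph _ _](_ : _ = (i != j)) // eq0 (opp j i).
  move: (ltn_ord (i - j)%R).
  move: (nat_of_ord _) => [|x] hx; first by rewrite subn0 modnn.
  rewrite modn_small; last by lia.
  by lia.
rewrite (opp i j); move: (ltn_ord (j - i)%R).
move: (nat_of_ord _) => x hx h.
rewrite modn_small; last by lia.
by lia.
Qed.

Lemma circulant_outdeg r i : outdeg (circulant r) i = r.
Proof.
have -> : outdeg (circulant r) i = #|[set x : 'I_r.*2.+1 | 0 < x <= r]|.
  (* Translation by [i] carries the interval [1..r] onto the out-neighbourhood of [i]. *)
  rewrite -[RHS](card_imset _ (GRing.addIr i)); apply: eq_card => j.
  apply/idP/imsetP; rewrite inE.
    by move=> h; exists (j - i)%R; rewrite ?GRing.subrK // inE.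
  case=> x; rewrite inE => h ->; change (0 < nat_of_ord (x + i - i)%R <= r).
  by rewrite GRing.addrK.
rewrite -sum1dep_card -(big_mkord (fun x => 0 < x <= r) (fun=> 1)).
rewrite (big_cat_nat _ (n := r.+1)) //=; last by lia.
rewrite [X in _ + X]big_nat_cond [X in _ + X]big_pred0 ?addn0; last by move=> x; lia.
rewrite big_ltn_cond //= big_nat_cond (eq_bigl (fun x => (1 <= x < r.+1) && true)).
  by rewrite -big_nat_cond sum_nat_const_nat; lia.
by move=> x; lia.
Qed.

Lemma circulant_indeg r i : indeg (circulant r) i = r.
Proof.
have := tournament_deg (circulant_tournament r) i.
by rewrite circulant_outdeg card_ord; lia.
Qed.

Definition ordered_sum {A B : finType} (T : rel A) (U : rel B) : rel (A + B) :=
  fun x y => match x, y with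
    | inl x, inl y => T x y
    | inr x, inr y => U x y
    | inl _, inr _ => true
    | inr _, inl _ => false
    end.

Lemma ordered_sum_tournament {A B : finType} (T : rel A) (U : rel B) :
  tournament T -> tournament U -> tournament (ordered_sum T U).
Proof.
move=> hT hU; split=> [] [x|x] [y|y] //=;
  [exact: hT.1|exact: hU.1|exact: hT.2|exact: hU.2].
Qed.

Lemma card_sum_set {A B : finType} (P : pred (A + B)) :
  #|[set x | P x]| = #|[set x | P (inl x)]| + #|[set x | P (inr x)]|.
Proof.
rewrite -!sum1dep_card big_mkcond /= big_sumType /=.
by rewrite -!big_mkcond.
Qed.

Lemma ordered_sum_sum_deg {A B : finType} (T : rel A) (U : rel B)
    (g : nat -> nat -> nat) :
  let D := ordered_sum T U in
  \sum_w g (indeg D w) (outdeg D w) =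
  \sum_x g (indeg T x) (outdeg T x + #|B|) +
  \sum_y g (#|A| + indeg U y) (outdeg U y).
Proof.
rewrite /= big_sumType /=; congr (_ + _); apply: eq_bigr => x _.
  rewrite /indeg /outdeg !card_sum_set /= cards0.
  by rewrite addn0 -[#|B|]cardsT; congr (g _ (_ + _));
    apply: eq_card => y; rewrite !inE.
rewrite /indeg /outdeg !card_sum_set /= cards0 -[#|A|]cardsT.
by congr (g (_ + _) _); apply: eq_card => y; rewrite !inE.
Qed.

(** Star counts only see degrees, so the tournament is exposed through its degree sums alone; [g]
    will be [x ^ a * y ^ b]. Regularity of both blocks leaves two constant terms, the dominating
    block first. *)
Lemma two_block_tournament p r :
  exists (W : finType) (T : rel W),
  [/\ tournament T, #|W| = p.*2.+1 + r.*2.+1 &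
   forall g : nat -> nat -> nat, \sum_w g (indeg T w) (outdeg T w) =
    p.*2.+1 * g p (p + r.*2.+1) + r.*2.+1 * g (p.*2.+1 + r) r].
Proof.
exists _, (ordered_sum (circulant p) (circulant r)); split.
- by apply: ordered_sum_tournament; exact: circulant_tournament.
- by rewrite card_sum !card_ord.
move=> g; rewrite ordered_sum_sum_deg !card_ord; congr (_ + _).
  under eq_bigr do rewrite circulant_indeg circulant_outdeg.
  by rewrite sum_nat_const card_ord.
under eq_bigr do rewrite circulant_indeg circulant_outdeg.
by rewrite sum_nat_const card_ord.
Qed.

End Blocks.

(** * Tangent line and power mean inequalities *)

(** The right side is [x ^+ n.+1] and the left side its tangent line at [c]. Multiplying the bound
    for [n] by [x] overshoots the next tangent line by [(n + 1) * c ^+ n * (x - c) ^+ 2]. *)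
Lemma expr_ge_tangent (R : realFieldType) (c x : R) n : 0 <= c -> 0 <= x ->
  c ^+ n * (n.+1%:R * x - n%:R * c) <= x ^+ n.+1.
Proof.
move=> c0 x0; elim: n => [|n IH].
  by rewrite expr0 expr1 mul1r mul1r mul0r subr0.
rewrite [leRHS]exprS; apply: le_trans (ler_wpM2l x0 IH).
rewrite -subr_ge0 exprS -[n.+2%:R]natr1 -[n.+1%:R]natr1.
rewrite (_ : _ - _ = (n%:R + 1) * c ^+ n * (x - c) ^+ 2); last by ring.
apply: mulr_ge0 (sqr_ge0 _); apply: mulr_ge0 (exprn_ge0 _ c0).
by rewrite addr_ge0.
Qed.

(** Jensen's inequality for powers: the tangent lines at the mean [c] are summed, and their linear
    parts add up exactly. *)
Lemma sum_expr_ge (R : realFieldType) (I : finType) (F : I -> R) (c : R) n :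
  0 <= c -> (forall i, 0 <= F i) -> \sum_i F i = #|I|%:R * c ->
  #|I|%:R * c ^+ n <= \sum_i F i ^+ n.
Proof.
move=> c0 F0 sumF; case: n => [|n].
  by rewrite expr0 mulr1; under eq_bigr do rewrite expr0; rewrite sumr_const.
apply: le_trans (ler_sum _ (fun i _ => expr_ge_tangent _ _ _ n c0 (F0 i))).
rewrite -mulr_sumr sumrB -mulr_sumr sumF sumr_const -mulr_natl -natr1 exprS.
by rewrite le_eqVlt -subr_eq0; apply/orP; left; apply/eqP; ring.
Qed.

(** * Two-block tournaments violating the density bounds *)

Section Constructions.
Local Open Scope nat_scope.

Lemma leq_expl m n e : m <= n -> m ^ e <= n ^ e.
Proof. by case: e => // e mn; rewrite leq_exp2r. Qed.

(** With [Z = M.+1 ^ (a + b)], the first term is at most [Z] after doubling and the second at most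
    [2 * M * Z]. Together with the extra [Z] this makes [2 * M.+1 * Z]. *)
Lemma sparse_bound a b M : a <= b -> 0 < a -> M.+1 = 2 ^ b.+1 ->
  2 * ((2 * M + 1) ^ b + M * ((M + 2) ^ a * M ^ b)) + M.+1 ^ (a + b)
    <= 2 * M.+1 ^ (a + b).+1.
Proof.
move=> ab a0 hM.
have h1 : M * ((M + 2) ^ a * M ^ b) <= M * M.+1 ^ (a + b).
  (* Pair [a] factors [M + 2] with [a] factors [M]: each product is at most [M.+1 ^ 2]. *)
  rewrite leq_mul2l; apply/orP; right.
  rewrite -[in M ^ b](subnK ab) expnD mulnCA -expnMn.
  rewrite (_ : a + b = (b - a) + (2 * a)); last by lia.
  rewrite expnD leq_mul // ?leq_expl // expnM leq_expl //; nia.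
have h2 : 2 * (2 * M + 1) ^ b <= M.+1 ^ (a + b).
  apply: (@leq_trans (2 * (2 * M.+1) ^ b)).
    by rewrite leq_mul2l /= leq_expl //; lia.
  by rewrite expnMn mulnA -expnS -hM -expnS leq_pexp2l //; lia.
by rewrite expnS; nia.
Qed.

(* The dominated block is [M] times as large as the dominating one. Since
   [a > 0], the latter contributes a factor [1 / M.+1 ^ a.+1], which
   [M.+1 = 2 ^ b.+1] makes negligible. *)
Lemma sparse_tournament a b : 0 < a -> a <= b -> exists d : nat, forall n0 : nat,
  exists (W : finType) (T : rel W), [/\ tournament T, n0 < #|W| &
    d.+1 * (2 ^ (a + b) * \sum_w indeg T w ^ a * outdeg T w ^ b)
      <= d * #|W| ^ (a + b).+1].
Proof.
move=> a0 ab; pose K := (2 ^ b).-1; pose M := K.*2.+1.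
have hK : K.+1 = 2 ^ b by rewrite prednK ?expn_gt0.
have hM : M.+1 = 2 ^ b.+1 by rewrite expnS -hK /M; lia.
(* The saving in [sparse_bound] is the ratio [(2 * M + 1) / (2 * M + 2)], whatever the size [p]. As
   [M = 2 * K + 1], the choice of [r] makes the second block exactly [M] times the first. *)
exists (2 * M + 1) => p; pose q := p.*2.+1; pose r := p * M + K.
have hr : r.*2.+1 = q * M by rewrite /q /r /M; nia.
have [W [T [hT cW sumT]]] := two_block_tournament p r.
exists W, T; split=> //; first by rewrite cW; lia.
rewrite (sumT (fun x y => x ^ a * y ^ b)) cW hr -/q.
have -> : q + q * M = q * M.+1 by rewrite mulnS.
have h1 : 2 ^ (a + b) * (p ^ a * (p + q * M) ^ b) <= q ^ (a + b) * (2 * M + 1) ^ b.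
  rewrite !expnD mulnACA -!expnMn -mulnA -expnMn.
  by rewrite leq_mul // leq_expl // /q; nia.
have h2 : 2 ^ (a + b) * ((q + r) ^ a * r ^ b) <=
    q ^ (a + b) * ((M + 2) ^ a * M ^ b).
  rewrite !expnD mulnACA [leqRHS]mulnACA -!expnMn.
  by rewrite leq_mul // leq_expl //; nia.
have := sparse_bound a b M ab a0 hM.
set Z := M.+1 ^ (a + b) => h3.
have h4 : 2 ^ (a + b) * (q * (p ^ a * (p + q * M) ^ b) +
    q * M * ((q + r) ^ a * r ^ b)) <=
    q ^ (a + b).+1 * ((2 * M + 1) ^ b + M * ((M + 2) ^ a * M ^ b)).
  rewrite expnS [leqLHS]mulnDr [leqRHS]mulnDr; apply: leq_add.
    by rewrite mulnCA -mulnA leq_mul2l h1 orbT.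
  by rewrite mulnCA [leqRHS]mulnACA leq_mul2l h2 orbT.
rewrite expnMn; move: h3 h4; rewrite [M.+1 ^ _.+1]expnS -/Z.
move: (_ + M * _) => E h3 h4.
apply: (leq_trans (leq_mul (leqnn _) h4)).
rewrite mulnCA [leqRHS]mulnCA leq_mul2l; apply/orP; right.
have h5 : 2 * E <= (2 * M + 1) * Z by lia.
rewrite (_ : _.+1 * E = M.+1 * (2 * E)) 1?[leqRHS]mulnCA; last by lia.
by rewrite leq_mul2l h5 orbT.
Qed.

(** The base of the left power is the order of the tournament; on the right are twice the in- and
    out-degrees in the dominating block, up to one spare factor [c.+1 * c] for its size. Put
    [k = a.+1] and [Y = c.+1 ^ 2]. To leading order [(M * L) ^ k] loses a proportion [3 * k / Y]
    against [X ^ (2 * k)], while the last [L] gains [c / Y] over [X]; [c = 6 * k] wins. *)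
Lemma dense_bound a b c : a.+2 <= b -> c = 6 * a.+1 ->
  (c.+1 ^ 2).+1 ^ (a + b).+1 < (c.+1 * c) ^ a.+1 * (c.+1 * c.+2) ^ b.
Proof.
move=> ab hc; set X := (c.+1 ^ 2).+1; set M := c.+1 * c; set L := c.+1 * c.+2.
have XL : X <= L by rewrite /X /L; lia.
(* Since [X <= L], it is enough to treat [b = a + 2]. *)
suff h : X ^ (2 * a + 3) < (M * L) ^ a.+1 * L.
  rewrite (_ : (a + b).+1 = 2 * a + 3 + (b - a.+2)); last by lia.
  rewrite -[e in L ^ e](subnKC ab) !(expnD _ _ (b - _)) mulnA.
  rewrite [L ^ a.+2]expnSr mulnA -expnMn.
  apply: (leq_ltn_trans (leq_mul (leqnn _) (leq_expl _ _ _ XL))).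
  by rewrite ltn_pmul2r // expn_gt0.
pose k : rat := a.+1%:R.
have k1 : (1 <= k)%R by rewrite ler1n.
have cE : (c%:R = 6 * k :> rat)%R by rewrite hc natrM.
pose Y : rat := (c.+1%:R ^+ 2)%R.
have XE : (X%:R = Y + 1 :> rat)%R by rewrite -natr1 natrX.
have YE : (Y = (6 * k + 1) ^+ 2)%R by rewrite /Y -natr1 cE.
have MLE : ((M * L)%:R = Y * (Y - 1) :> rat)%R.
  by rewrite YE /M /L !natrM -!natr1 cE; ring.
have LE : (L%:R = Y + 6 * k + 1 :> rat)%R.
  by rewrite YE /L natrM -!natr1 cE; ring.
rewrite -(ltr_nat rat) natrX natrM natrX XE MLE LE.
have Y1 : (1 <= Y)%R by rewrite YE; nra.
have Y0 : (0 <= Y * (Y - 1))%R by nra.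
(* The tangent line at [X ^ 2] bounds [(M * L) ^ k] below, leaving a cubic inequality in [Y]. *)
have := expr_ge_tangent _ ((Y + 1) ^+ 2)%R _ a (sqr_ge0 _) Y0.
rewrite -[a%:R%R](addrK 1%R) natr1 -/k -exprM => h.
have L0 : (0 <= Y + 6 * k + 1)%R by lra.
apply: lt_le_trans (ler_wpM2r L0 h).
rewrite exprD -mulrA ltr_pM2l; last by apply: exprn_gt0; lra.
rewrite -subr_gt0 (_ : (_ - _)%R =
  (3 * k * (Y + 1) * (Y - 6 * k + 1) + 2 * k * (Y + 6 * k + 1))%R); last by ring.
have : (6 * k <= Y)%R by rewrite YE; nra.
by move=> ?; apply: addr_gt0; rewrite !mulr_gt0 //; lra.
Qed.

(* With [c = 6 * a.+1], the dominating block has [c.+1 * c + 1] vertices and the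
   dominated one [c.+1]. *)
Lemma dense_tournament a b : a.+2 <= b -> exists (W : finType) (T : rel W),
  [/\ tournament T, 0 < #|W| &
    #|W| ^ (a + b).+1 < 2 ^ (a + b) * \sum_w indeg T w ^ a * outdeg T w ^ b].
Proof.
move=> ab; pose c := 6 * a.+1; pose r := 3 * a.+1; pose p := r * c.+1.
have [W [T [hT cW sumT]]] := two_block_tournament p r.
have cr : r.*2 = c by rewrite /c /r; lia.
have cp : p.*2 = c.+1 * c by rewrite /p -cr; lia.
exists W, T; split=> //; first by rewrite cW.
rewrite (sumT (fun x y => x ^ a * y ^ b)) cW.
have -> : p.*2.+1 + r.*2.+1 = (c.+1 ^ 2).+1 by rewrite cp cr; lia.
apply: leq_trans (dense_bound a b c ab erefl) _; rewrite mulnDr.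
(* The dominating block alone suffices: the dominated one is dropped, and below [2p+1] vertices are
   counted as [2p]. *)
apply: leq_trans (leq_addr _ _).
have -> : (c.+1 * c) ^ a.+1 * (c.+1 * c.+2) ^ b =
    p.*2 * (2 ^ (a + b) * (p ^ a * (p + r.*2.+1) ^ b)).
  rewrite expnD mulnACA -!expnMn mul2n cp mulnA -expnS; congr (_ * _ ^ _).
  by rewrite mulnDr mul2n cp cr; lia.
by rewrite [leqRHS]mulnCA leq_mul2r leqnSn orbT.
Qed.

End Constructions.

(** * Densities of stars and the two Sidorenko properties *)

(** Bernoulli's inequality, from the tangent line at [n] evaluated at [n - 1]. It absorbs into [eps]
    the gap between the mean degree [(n - 1) / 2] and [n / 2]. *)
Lemma expr_sub1_ge (R : realFieldType) (n eps : R) s :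
  1 <= n -> s%:R <= eps * n -> (1 - eps) * n ^+ s <= (n - 1) ^+ s.
Proof.
move=> n1; case: s => [|s] hs; first by rewrite !expr0 mulr1; nra.
have n0 : 0 <= n by lra.
have m0 : 0 <= n - 1 by lra.
apply: le_trans (expr_ge_tangent _ _ _ s n0 m0).
rewrite exprSr mulrCA; apply: ler_wpM2l; first exact: exprn_ge0.
by rewrite -natr1 in hs *; lra.
Qed.

Section Density.
Variables (s : nat) (V : finType) (S : rel V) (v : V).
Hypothesis hS : star_orientation s S v.
Let a := indeg S v.
Let b := outdeg S v.

Lemma star_density {W : finType} (T : rel W) : hom_density S T =
  (\sum_w indeg T w ^ a * outdeg T w ^ b)%N%:R / #|W|%:R ^+ s.+1.
Proof. by rewrite /hom_density (star_hom_count _ _ _ _ hS) hS.1 natrX. Qed.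

(** Clearing denominators gives an inequality between naturals, the form in which the constructions
    and AM-GM are stated. *)
Lemma star_density_le {W : finType} (T : rel W) : (0 < #|W|)%N ->
  (hom_density S T <= 2^-1 ^+ num_edges S) =
  (2 ^ s * (\sum_w indeg T w ^ a * outdeg T w ^ b) <= #|W| ^ s.+1)%N.
Proof.
move=> W0; rewrite star_density (star_num_edges _ _ _ _ hS) exprVn.
rewrite ler_pdivrMr ?exprn_gt0 ?ltr0n // ler_pdivlMl ?exprn_gt0 //.
by rewrite -(ler_nat rat) natrM !natrX.
Qed.

Lemma star_not_Sidorenko : (0 < a)%N -> (0 < b)%N -> ~ tournament_Sidorenko S.
Proof.
move=> a0 b0 hsid.
have [d hd] : exists d : nat, forall n0 : nat,
  exists (W : finType) (T : rel W), [/\ tournament T, (n0 < #|W|)%N &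
    (d.+1 * (2 ^ s * \sum_w indeg T w ^ a * outdeg T w ^ b)
      <= d * #|W| ^ s.+1)%N].
  rewrite -(star_deg _ _ _ _ hS) -/a -/b; have [ab|/ltnW ba] := leqP a b.
    exact: sparse_tournament.
  have [d hd] := sparse_tournament b a b0 ba; exists d => n0.
  have [W [T [hT nW h]]] := hd n0; exists W, (reverse T).
  split=> //; first exact: reverse_tournament.
  rewrite addnC; move: h; congr (_ * (_ * _) <= _)%N.
  by apply: eq_bigr => w _; rewrite mulnC.
have dpos : 0 < (d.+1.*2)%:R :> rat by rewrite ltr0n.
(* The construction has density at most [(1 - 1 / d.+1) * 2 ^- s] for arbitrarily large orders; half
   of that deficit is a contradictory [eps]. *)
have [|n0 hn0] := hsid (d.+1.*2)%:R^-1; first by rewrite invr_gt0.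
have [W [T [hT nW h]]] := hd n0.
have := hn0 W T hT (ltnW nW).
rewrite star_density (star_num_edges _ _ _ _ hS) exprVn => hle.
have W0 : 0 < #|W|%:R ^+ s.+1 :> rat by rewrite exprn_gt0 // ltr0n; lia.
have t0 : 0 < 2 ^+ s :> rat by rewrite exprn_gt0.
move: hle; rewrite ler_pdivlMr // mulrAC ler_pdivrMr // => hle.
move: h; rewrite -(ler_nat rat) !natrM !natrX.
move: hle W0; move: (\sum_w _)%N%:R (_ ^+ s.+1) => F n hle n0' h.
have := le_trans (ler_wpM2l (ler0n _ d.+1) hle) _.
rewrite -[F * _]mulrC => /(_ _ h).
rewrite mulrA ler_pM2r // mulrBr mulr1 -muln2 natrM invfM mulrA divff ?pnatr_eq0 //.
by rewrite -natr1 => ?; lra.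
Qed.

Lemma star_Sidorenko : a = 0%N \/ b = 0%N -> tournament_Sidorenko S.
Proof.
(* The Archimedean bound gives [s <= eps * #|W|], as [expr_sub1_ge] requires; the successor also
   makes [W] nonempty. *)
move=> ab0 eps eps0; exists (Num.bound (s%:R / eps)).+1 => W T hT nW.
have W0 : 0 < #|W|%:R :> rat by rewrite ltr0n; lia.
rewrite star_density (star_num_edges _ _ _ _ hS) ler_pdivlMr ?exprn_gt0 //.
(* Whichever exponent vanishes, the count is a sum of [s]-th powers of one degree sequence, of mean
   [(#|W| - 1) / 2]. *)
have [D sumD ->] : exists2 D : W -> nat,
    (2 * (\sum_w D w) = #|W| * #|W|.-1)%N &
    (\sum_w indeg T w ^ a * outdeg T w ^ b = \sum_w D w ^ s)%N.
  have sab := star_deg _ _ _ _ hS; rewrite -/a -/b in sab.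
  case: ab0 => e; rewrite e in sab *.
    exists (outdeg T); first exact: tournament_sum_outdeg.
    by apply: eq_bigr => w _; rewrite mul1n -sab.
  exists (indeg T).
    by rewrite sum_indeg_outdeg; exact: tournament_sum_outdeg.
  by apply: eq_bigr => w _; rewrite muln1 -sab addn0.
set n : rat := #|W|%:R; pose c : rat := (n - 1) / 2.
have n1 : 1 <= n by rewrite ler1n; lia.
have c0 : 0 <= c by rewrite /c; lra.
rewrite natr_sum; under eq_bigr do rewrite natrX.
apply: le_trans (sum_expr_ge _ _ _ c s c0 _ _) => //; last first.
  rewrite -natr_sum; apply: (@mulfI _ 2%:R) => //.
  rewrite -natrM sumD natrM -/n /c (_ : (#|W|.-1)%:R = n - 1); first by field.
  by rewrite /n -[in RHS](ltn_predK nW) -natr1 addrK.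
rewrite -/n /c exprMn exprS.
have h : (1 - eps) * n ^+ s <= (n - 1) ^+ s.
  apply: expr_sub1_ge => //; rewrite mulrC -ler_pdivrMr //; apply: ltW.
  apply: lt_le_trans (archi_boundP _) _; first by rewrite divr_ge0 ?ler0n // ltW.
  by rewrite ler_nat; exact: ltnW.
have t0 : 0 <= n * 2^-1 ^+ s by rewrite mulr_ge0 ?exprn_ge0 // ltW.
have := ler_wpM2l t0 h; congr (_ <= _); ring.
Qed.

Lemma star_anti_Sidorenko :
  (a <= b.+1)%N -> (b <= a.+1)%N -> tournament_anti_Sidorenko S.
Proof.
move=> ab ba W T hT W0; rewrite star_density_le //.
have sab := star_deg _ _ _ _ hS; rewrite -/a -/b in sab.
(* Here [m] is the smaller exponent and [k] the difference, 0 or 1. AM-GM will bound the balanced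
   part at each vertex; the leftover [D] is only bounded on average. *)
have [m [k [D [sm hD sumD]]]] : exists (m k : nat) (D : W -> nat),
  [/\ s = (2 * m + k)%N,
      forall w, (indeg T w ^ a * outdeg T w ^ b =
        (indeg T w * outdeg T w) ^ m * D w)%N &
      (2 ^ k * (\sum_w D w) <= #|W| ^ k.+1)%N].
  have sumT := tournament_sum_outdeg hT.
  have [e|[e|e]] : a = b \/ b = a.+1 \/ a = b.+1 by lia.
  - exists a, 0%N, (fun=> 1%N); split=> [|w|]; first by lia.
      by rewrite -e expnMn muln1.
    by rewrite sum_nat_const muln1 mul1n.
  - exists a, 1%N, (outdeg T); split=> [|w|]; first by lia.
      by rewrite e expnMn expnSr mulnA.
    by rewrite expn1 sumT leq_mul // leq_pred.
  - exists b, 1%N, (indeg T); split=> [|w|]; first by lia.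
      by rewrite e expnMn expnSr mulnAC.
    by rewrite expn1 sum_indeg_outdeg sumT leq_mul // leq_pred.
under eq_bigr do rewrite hD.
rewrite sm -addnS (expnD 2) (expnD #|W|) (expnM #|W|) -mulnA.
apply: leq_trans (leq_mul (leqnn _) sumD); rewrite mulnCA [leqRHS]mulnCA.
rewrite leq_mul2l; apply/orP; right.
rewrite !big_distrr; apply: leq_sum => w _ /=.
rewrite mulnA leq_mul2r expnM -expnMn; apply/orP; right.
apply: leq_expl; rewrite -(tournament_deg hT w).
(* The two degrees add up to [#|W| - 1], and rounding up to [#|W|] makes the bound hold without
   error term. *)
exact: leq_trans (nat_AGM2 _ _) (leq_expl _ _ 2 (leqnSn _)).
Qed.

Lemma star_not_anti_Sidorenko :
  (a.+2 <= b)%N || (b.+2 <= a)%N -> ~ tournament_anti_Sidorenko S.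
Proof.
move=> hab hanti.
suff [W [T [hT W0]]] : exists (W : finType) (T : rel W),
  [/\ tournament T, (0 < #|W|)%N &
    (#|W| ^ s.+1 < 2 ^ s * \sum_w indeg T w ^ a * outdeg T w ^ b)%N].
  by rewrite ltnNge -star_density_le // hanti.
rewrite -(star_deg _ _ _ _ hS) -/a -/b; case/orP: hab.
  exact: dense_tournament.
(* When the in-degree is the larger one, reverse the tournament. *)
move=> /dense_tournament[W [T [hT W0 h]]]; exists W, (reverse T).
split=> //; first exact: reverse_tournament.
rewrite addnC; apply: (leq_trans h); rewrite leq_mul2l; apply/orP; right.
by apply: leq_sum => w _; rewrite mulnC.
Qed.

End Density.

Theorem theorem1p11 (s : nat) (V : finType) (S : rel V) (v : V)
    (hS : star_orientation s S v) :
  [/\ tournament_Sidorenko S <->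
        (exists f : {ffun V -> bool}, is_hom S directed_edge f),
      (exists f : {ffun V -> bool}, is_hom S directed_edge f) <->
        (forall x y, S x y -> y = v) \/ (forall x y, S x y -> x = v)
    & tournament_anti_Sidorenko S <->
        `|(indeg S v)%:Z - (outdeg S v)%:Z| <= 1 ].
Proof.
have hom := star_hom_edge s V S v hS.
have inout := star_in_or_out s V S v hS.
split=> //.
- split=> [sid|/hom/inout h]; last first.
    by apply: star_Sidorenko hS _; case: h; [right|left].
  apply/hom/inout.
  have [|b0] := posnP (outdeg S v); first by left.
  have [|a0] := posnP (indeg S v); first by right.
  by case: (star_not_Sidorenko _ _ _ _ hS a0 b0 sid).
- split=> [anti|h]; last by apply: star_anti_Sidorenko hS _ _; lia.
  have [] := boolP (((indeg S v).+2 <= outdeg S v) || ((outdeg S v).+2 <= indeg S v))%N.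
    by move=> h; case: (star_not_anti_Sidorenko _ _ _ _ hS h anti).
  by lia.
Qed.
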